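(* Let $Q\in[0,1]$, $\eta\in\mathbb{D}$, and consider the symmetric restricted attack parameters $q_0=q_1=\sqrt{1-Q}$, $\eta_0=\eta$, $\eta_1=-\overline{\eta}$, with $\ket{e}=\eta\ket0_E+\sqrt{1-|\eta|^2}\ket1_E$, $\ket{f}=-\overline{\eta}\ket0_E+\sqrt{1-|\eta|^2}\ket1_E$. Define the isometry $\mathbf{Rw}$ on $\mathrm{span}\{\ket{00},\ket{11}\}\subseteq\mathcal{H}_{A_1A_2}$ by $\mathbf{Rw}\ket{00}=\sqrt{1-Q}\ket{0}\ket{0}\ket{0}_E+\sqrt{Q}\ket{1}\ket{0}\ket{f}$ and $\mathbf{Rw}\ket{11}=\sqrt{Q}\ket{0}\ket{1}\ket{e}+\sqrt{1-Q}\ket{1}\ket{1}\ket{0}_E$ (order $A_1A_2E$). Let $V$ be a unitary on $\mathcal{H}_{A_2}\otimes\mathcal{H}_E$ and define vectors $\ket{e_i},\ket{f_i}\in\mathcal{H}_E$ ($i=0,\dots,3$) by $V\ket{0}\ket{0}_E=\ket0\ket{e_0}+\ket1\ket{e_1}$, $V\ket1\ket0_E=\ket0\ket{e_2}+\ket1\ket{e_3}$, $V\ket0\ket f=\ket0\ket{f_0}+\ket1\ket{f_1}$, $V\ket1\ket e=\ket0\ket{f_2}+\ket1\ket{f_3}$. Assume $\braket{e_0|e_0}=\braket{e_3|e_3}=\braket{f_0|f_0}=\braket{f_3|f_3}=1-Q$ and $\braket{e_1|e_1}=\braket{e_2|e_2}=\braket{f_1|f_1}=\braket{f_2|f_2}=Q$.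 Let $W=(I_{A_1}\otimes V)\mathbf{Rw}$, let $\tau=W\ket{\Phi^+}\bra{\Phi^+}W^*$ with $\ket{\Phi^+}=\tfrac1{\sqrt2}(\ket{00}+\ket{11})$ (the Reflect state of $\Pi^*$ with $p_0=1/2$), and let $\sigma=\tfrac12 W\ket{00}\bra{00}W^*+\tfrac12W\ket{11}\bra{11}W^*$ (the Measure-and-Resend state of $\Pi^*$ with $p_0=1/2$, Bob's register traced out). Set \[ \delta=2Q(1-Q)+\Big(\tfrac12+2Q(1-Q)\Big)\,h\!\left(\frac{4Q(1-Q)}{1+4Q(1-Q)}\right). \] Then $S(A_1^Z|E)_\sigma\ge f(Q)$, where $f(Q)=S(A_1^Z|E)_\tau-\delta$ if $S(A_1^Z|E)_\tau\ge2\delta$, and $f(Q)=\tfrac12S(A_1^Z|E)_\tau$ otherwise.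
   Context: $\mathcal{H}_{A_1}=\mathcal{H}_{A_2}=\mathbb{C}^2$; $\mathcal{H}_E$ is a finite-dimensional Hilbert space with fixed orthonormal vectors $\ket0_E,\ket1_E$; $\mathbb{D}=\{z\in\mathbb{C}:|z|\le1\}$. $h$ is the binary entropy (base-2 logarithms). For a state $\rho$ on $A_1A_2E$, $S(A_1^Z|E)_\rho=S(A_1^ZE)-S(E)$ evaluated on $\rho_{A_1^ZE}=\sum_{a\in\{0,1\}}\ket a\bra a\otimes\mathrm{tr}_{A_1A_2}[(\ket a\bra a_{A_1}\otimes I)\rho]$, i.e. after measuring $A_1$ in the computational basis and tracing out $A_2$. *)

(* Defs.v *)
From Stdlib Require Import Reals.
Open Scope R_scope.

Record Cpx := mkC { Re : R; Im : R }.
Definition RtoC (r : R) : Cpx := mkC r 0.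
Definition Czero : Cpx := RtoC 0.
Definition Cone : Cpx := RtoC 1.
Definition Cadd (a b : Cpx) : Cpx := mkC (Re a + Re b) (Im a + Im b).
Definition Copp (a : Cpx) : Cpx := mkC (- Re a) (- Im a).
Definition Cmul (a b : Cpx) : Cpx :=
  mkC (Re a * Re b - Im a * Im b) (Re a * Im b + Im a * Re b).
Definition Cconj (a : Cpx) : Cpx := mkC (Re a) (- Im a).
Definition Cnorm2 (a : Cpx) : R := Re a * Re a + Im a * Im a.

Fixpoint Csum (n : nat) (f : nat -> Cpx) : Cpx :=
  match n with O => Czero | S m => Cadd (Csum m f) (f m) end.
Fixpoint rsum (n : nat) (f : nat -> R) : R :=
  match n with O => 0 | S m => rsum m f + f m end.

Definition kron (i j : nat) : Cpx := if Nat.eqb i j then Cone else Czero.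

(** * Vectors of C^d are functions nat -> Cpx (only indices < d matter) *)
Definition inner (d : nat) (u v : nat -> Cpx) : Cpx :=
  Csum d (fun x => Cmul (Cconj (u x)) (v x)).
Definition vnorm2 (d : nat) (u : nat -> Cpx) : R := rsum d (fun x => Cnorm2 (u x)).

Definition etaR (x : R) : R := if Rlt_dec 0 x then - x * (ln x / ln 2) else 0.
Definition binH (p : R) : R := etaR p + etaR (1 - p).

Definition vn_entropy (n : nat) (M : nat -> nat -> Cpx) (s : R) : Prop :=
  exists (lam : nat -> R) (u : nat -> nat -> Cpx),
    (forall k l, (k < n)%nat -> (l < n)%nat ->
        Csum n (fun i => Cmul (Cconj (u k i)) (u l i)) = kron k l) /\
    (forall i j, (i < n)%nat -> (j < n)%nat ->
        M i j = Csum n (fun k => Cmul (RtoC (lam k)) (Cmul (u k i) (Cconj (u k j))))) /\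
    s = rsum n (fun k => etaR (lam k)).

(** * Operators on A1 A2 E = C^2 (x) C^2 (x) C^d :
    rho a1 a2 x a1' a2' x' = <a1 a2 x| rho |a1' a2' x'>. *)
Definition op3 := nat -> nat -> nat -> nat -> nat -> nat -> Cpx.
Definition vec3 := nat -> nat -> nat -> Cpx.

Definition proj3 (psi : vec3) : op3 :=
  fun a b x a' b' x' => Cmul (psi a b x) (Cconj (psi a' b' x')).
Definition op3_add (r1 r2 : op3) : op3 :=
  fun a b x a' b' x' => Cadd (r1 a b x a' b' x') (r2 a b x a' b' x').
Definition op3_scale (c : R) (r : op3) : op3 :=
  fun a b x a' b' x' => Cmul (RtoC c) (r a b x a' b' x').

(** rho_{A1^Z E} = sum_a |a><a| (x) tr_{A2}[(<a| (x) I) rho (|a> (x) I)],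
    as a (2d) x (2d) matrix, with index i <-> (i / d, i mod d) = (a, x). *)
Definition rhoZE (d : nat) (rho : op3) : nat -> nat -> Cpx :=
  fun i j =>
    let a := (i / d)%nat in let x := (i mod d)%nat in
    let a' := (j / d)%nat in let x' := (j mod d)%nat in
    if Nat.eqb a a' then Csum 2 (fun b => rho a b x a b x') else Czero.
Definition rhoE (d : nat) (rho : op3) : nat -> nat -> Cpx :=
  fun x x' => Csum 2 (fun a => Csum 2 (fun b => rho a b x a b x')).

Definition cond_entropy_ZE (d : nat) (rho : op3) (s : R) : Prop :=
  exists sZE sE, vn_entropy (2 * d) (rhoZE d rho) sZE /\
                 vn_entropy d (rhoE d rho) sE /\ s = sZE - sE.

(** * Operators on A2 E = C^2 (x) C^d : V b y a x = <b y| V |a x> *)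
Definition op2 := nat -> nat -> nat -> nat -> Cpx.

Definition unitary2 (d : nat) (V : op2) : Prop :=
  (forall a x a' x', (a < 2)%nat -> (x < d)%nat -> (a' < 2)%nat -> (x' < d)%nat ->
     Csum 2 (fun b => Csum d (fun y => Cmul (Cconj (V b y a x)) (V b y a' x')))
     = Cmul (kron a a') (kron x x')) /\
  (forall b y b' y', (b < 2)%nat -> (y < d)%nat -> (b' < 2)%nat -> (y' < d)%nat ->
     Csum 2 (fun a => Csum d (fun x => Cmul (V b y a x) (Cconj (V b' y' a x))))
     = Cmul (kron b b') (kron y y')).

Definition applyV (d : nat) (V : op2) (phi : nat -> nat -> Cpx) : nat -> nat -> Cpx :=
  fun b y => Csum 2 (fun a => Csum d (fun x => Cmul (V b y a x) (phi a x))).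
Definition ketE (a : nat) (v : nat -> Cpx) : nat -> nat -> Cpx :=
  fun a' x => if Nat.eqb a a' then v x else Czero.
Definition compV (d : nat) (V : op2) (a : nat) (v : nat -> Cpx) (b : nat) : nat -> Cpx :=
  fun y => applyV d V (ketE a v) b y.
Definition IxV (d : nat) (V : op2) (psi : vec3) : vec3 :=
  fun a1 => applyV d V (psi a1).

Definition evec (eta : Cpx) (k0 k1 : nat -> Cpx) : nat -> Cpx :=
  fun x => Cadd (Cmul eta (k0 x)) (Cmul (RtoC (sqrt (1 - Cnorm2 eta))) (k1 x)).
Definition fvec (eta : Cpx) (k0 k1 : nat -> Cpx) : nat -> Cpx :=
  fun x => Cadd (Cmul (Copp (Cconj eta)) (k0 x)) (Cmul (RtoC (sqrt (1 - Cnorm2 eta))) (k1 x)).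

Definition Rw00 (Q : R) (eta : Cpx) (k0 k1 : nat -> Cpx) : vec3 :=
  fun a b x => match a, b with
               | O, O => Cmul (RtoC (sqrt (1 - Q))) (k0 x)
               | 1%nat, O => Cmul (RtoC (sqrt Q)) (fvec eta k0 k1 x)
               | _, _ => Czero end.
Definition Rw11 (Q : R) (eta : Cpx) (k0 k1 : nat -> Cpx) : vec3 :=
  fun a b x => match a, b with
               | O, 1%nat => Cmul (RtoC (sqrt Q)) (evec eta k0 k1 x)
               | 1%nat, 1%nat => Cmul (RtoC (sqrt (1 - Q))) (k0 x)
               | _, _ => Czero end.

Definition tau_state (d : nat) (V : op2) (Q : R) (eta : Cpx) (k0 k1 : nat -> Cpx) : op3 :=
  proj3 (fun a b x => Cmul (RtoC (/ sqrt 2))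
          (Cadd (IxV d V (Rw00 Q eta k0 k1) a b x) (IxV d V (Rw11 Q eta k0 k1) a b x))).
Definition sigma_state (d : nat) (V : op2) (Q : R) (eta : Cpx) (k0 k1 : nat -> Cpx) : op3 :=
  op3_add (op3_scale (1/2) (proj3 (IxV d V (Rw00 Q eta k0 k1))))
          (op3_scale (1/2) (proj3 (IxV d V (Rw11 Q eta k0 k1)))).

Definition deltaQ (Q : R) : R :=
  2 * Q * (1 - Q) + (1/2 + 2 * Q * (1 - Q)) * binH (4 * Q * (1 - Q) / (1 + 4 * Q * (1 - Q))).

Definition fQ (Q sTau : R) : R :=
  if Rle_dec (2 * deltaQ Q) sTau then sTau - deltaQ Q else sTau / 2.

(* Main.v *)
(** Write [S(A|E)] for the conditional entropy of the cq-state obtained by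
    measuring [A_1], so that [S(A|E)_rho = - D(rho_ZE || 1 (x) rho_E)].  Let [tau']
    be the state obtained from [tau] by replacing [Phi+] with [Phi-]; then
    [sigma = (tau + tau') / 2].  Superadditivity of [S(A|E)] on unnormalised states
    and [S(A|E)_tau' >= 0] give [S(A|E)_sigma >= S(A|E)_tau / 2].

    For the other bound, with [e = 4Q(1-Q)], explicit positive operators [P], [N]
    satisfy [tau + N = tau' + P] and [tr P = e], because [V] preserves the
    orthogonality of [|0>|..>] and [|1>|..>].  Hence, as in the
    Alicki-Fannes-Winter continuity bound,
    [S_tau <= S(tau + N) = S(tau' + P) <= S_tau' + e + (1+e) h(e/(1+e))],
    so [S_tau' >= S_tau - 2 delta].

    Superadditivity is joint subadditivity of [D].  For spectra [lam], [mu] with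
    squared overlaps [w], [D(A||B) = G(1) - G(0)] where
    [G(r) = sum w_ij lam_i ln((1-r) mu_j + r lam_i)], and
    [(1-r) G'(r) = Phi_r(A,B) - tr A] with
    [Phi_r(A,B) = sup_X 2 Re tr X*A - (1-r) tr X*BX - r tr XAX*], a supremum of
    functionals that are linear in [(A,B)]; the mean value theorem concludes. *)

From Stdlib Require Import Reals.
From Stdlib Require Lra.
From mathcomp Require Import all_boot all_order all_algebra spectral sesquilinear.
From mathcomp Require Import complex Rstruct ring lra.
Require Import Defs.

Set Implicit Arguments.
Unset Strict Implicit.
Unset Printing Implicit Defensive.

Import Order.TTheory GRing.Theory Num.Theory.
Local Open Scope ring_scope.
Local Open Scope sesquilinear_scope.

(* Arguments of [ln] and of the functions below are read in [ring_scope]. *)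
Bind Scope ring_scope with R.
#[local] Arguments ln : clear scopes.

Local Notation C := (complex R).
Local Notation "x %:C" := (real_complex R x) (at level 1, format "x %:C").

(** * Adjoints, spectral decompositions and overlaps of eigenbases *)

Lemma conjCR (x : R) : (x%:C)^* = x%:C.
Proof. by apply/CrealP; rewrite complex_real. Qed.

Lemma adjmxM m n p (A : 'M[C]_(m, n)) (B : 'M[C]_(n, p)) :
  (A *m B)^t* = B^t* *m A^t*.
Proof. by rewrite trmx_mul map_mxM. Qed.

Lemma adjmxD m n (A B : 'M[C]_(m, n)) : (A + B)^t* = A^t* + B^t*.
Proof. by rewrite linearD /= map_mxD. Qed.

Lemma mxtrace_adj n (A : 'M[C]_n) : \tr (A^t*) = (\tr A)^*.
Proof.
by rewrite /mxtrace rmorph_sum; apply: eq_bigr => i _; rewrite !mxE.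
Qed.

Definition rdiag n (lam : 'I_n -> R) : 'M[C]_n := diag_mx (\row_i (lam i)%:C).

(** Eigenvectors are the columns of [U^t*], so row [i] of [U] is the bra of the [i]-th one.
    Decompositions are not unique; the results below hold for any choice of them. *)
Definition spectral_dec n (A U : 'M[C]_n) (lam : 'I_n -> R) : Prop :=
  U \is unitarymx /\ A = U^t* *m rdiag lam *m U.

Definition psdmx n (A : 'M[C]_n) : Prop :=
  A^t* = A /\ forall x : 'rV[C]_n, 0 <= (x *m A *m x^t*) 0 0.

Lemma hermitian_spectral_dec n (A : 'M[C]_n) : A^t* = A ->
  exists U lam, spectral_dec A U lam.
Proof.
move=> Aherm.
have Aherm' : A \is hermsymmx.
  by apply/is_hermitianmxP; rewrite expr0 scale1r Aherm.
have Areal := hermitian_spectral_diag_real Aherm'.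
have /orthomx_spectralP Aeq := hermitian_normalmx Aherm'.
have Uu := spectral_unitarymx A.
exists (spectralmx A), (fun i => complex.Re (spectral_diag A 0 i)); split=> //.
rewrite -invmx_unitary // {1}Aeq; congr (_ *m diag_mx _ *m _).
by apply/rowP => i; rewrite mxE RRe_real //; apply/mxOverP.
Qed.

(** This is [|<v_j|u_i>|^2], with [u_i] and [v_j] the columns of [U^t*] and [V^t*]. The entry is
    already real; [complex.Re] only moves it to [R]. *)
Definition overlap n (U V : 'M[C]_n) (i j : 'I_n) : R :=
  complex.Re (`|(V *m U^t*) j i| ^+ 2).

Lemma overlapE n (U V : 'M[C]_n) i j :
  (overlap U V i j)%:C = (V *m U^t*) j i * ((V *m U^t*) j i)^*.
Proof.
by rewrite /overlap RRe_real -?normCK // ger0_real // exprn_ge0.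
Qed.

Lemma overlap_ge0 n (U V : 'M[C]_n) i j : 0 <= overlap U V i j.
Proof. by rewrite -ler0c overlapE mul_conjC_ge0. Qed.

Lemma overlap_sym n (U V : 'M[C]_n) i j : overlap V U j i = overlap U V i j.
Proof.
apply: complexI; rewrite !overlapE.
have -> : U *m V^t* = (V *m U^t*)^t* by rewrite adjmxM trmxCK.
by rewrite !mxE /= conjCK mulrC.
Qed.

Lemma spectral_dec_overlap n (A U V : 'M[C]_n) lam j : spectral_dec A U lam ->
  (V *m A *m V^t*) j j = (\sum_i overlap U V i j * lam i)%:C.
Proof.
case=> Uu ->; rewrite rmorph_sum /=.
have -> : V *m (U^t* *m rdiag lam *m U) *m V^t* =
          (V *m U^t*) *m rdiag lam *m (V *m U^t*)^t*.
  by rewrite adjmxM trmxCK !mulmxA.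
rewrite mxE; apply: eq_bigr => i _.
rewrite rmorphM /= overlapE; move: (V *m U^t*) => N.
by rewrite mul_mx_diag !mxE /= mulrAC.
Qed.

(** Every unitary diagonalises the identity with all eigenvalues equal to 1, so the sum is a
    diagonal entry of the identity in the basis [V]. *)
Lemma overlap_suml n (U V : 'M[C]_n) j : U \is unitarymx -> V \is unitarymx ->
  \sum_i overlap U V i j = 1.
Proof.
move=> Uu Vu.
have S1 : spectral_dec 1%:M U (fun=> 1).
  split=> //; have -> : rdiag (fun=> 1) = 1%:M :> 'M[C]_n.
    by apply/matrixP => k l; rewrite !mxE.
  move: Uu; rewrite -trmxC_unitary => /unitarymxP.
  by rewrite trmxCK mulmx1.
rewrite -(eq_bigr _ (fun i _ => mulr1 _)); apply: complexI.
by rewrite -(spectral_dec_overlap V j S1) mulmx1 (unitarymxP Vu) mxE eqxx.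
Qed.

Lemma overlap_sumr n (U V : 'M[C]_n) i : U \is unitarymx -> V \is unitarymx ->
  \sum_j overlap U V i j = 1.
Proof.
move=> Uu Vu; rewrite -(overlap_suml i Vu Uu).
by apply: eq_bigr => j _; rewrite overlap_sym.
Qed.

Lemma psdmxD n (A B : 'M[C]_n) : psdmx A -> psdmx B -> psdmx (A + B).
Proof.
move=> [hA pA] [hB pB]; split=> [|x]; first by rewrite adjmxD hA hB.
by rewrite mulmxDr mulmxDl mxE addr_ge0.
Qed.

Lemma psdmx_diag_ge0 m n (A : 'M[C]_n) (V : 'M[C]_(m, n)) j : psdmx A ->
  0 <= (V *m A *m V^t*) j j.
Proof.
move=> [_ /(_ (row j V))]; rewrite -!row_mul.
rewrite mxE [in X in X -> _]mxE [in X in _ -> X]mxE.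
suff -> : \sum_k (V *m A) j k * ((row j V)^t*) k 0 =
          \sum_k (V *m A) j k * (V^t*) k j by [].
by apply: eq_bigr => k _; rewrite !mxE.
Qed.

Lemma spectral_dec_eig n (A U : 'M[C]_n) lam j : spectral_dec A U lam ->
  (U *m A *m U^t*) j j = (lam j)%:C.
Proof.
case=> Uu ->; rewrite !mulmxA (unitarymxP Uu) mul1mx -mulmxA (unitarymxP Uu).
by rewrite mulmx1 !mxE eqxx mulr1n.
Qed.

Lemma spectral_dec_ge0 n (A U : 'M[C]_n) lam j : psdmx A ->
  spectral_dec A U lam -> 0 <= lam j.
Proof. by move=> pA /(spectral_dec_eig j) /esym E; rewrite -ler0c E psdmx_diag_ge0. Qed.

Lemma spectral_dec_trace n (A U : 'M[C]_n) lam : spectral_dec A U lam ->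
  \tr A = (\sum_i lam i)%:C.
Proof.
case=> Uu ->; rewrite -mulmxA mxtrace_mulC -mulmxA (unitarymxP Uu) mulmx1.
by rewrite mxtrace_diag rmorph_sum; apply: eq_bigr => i _; rewrite mxE.
Qed.

(** The [j]-th diagonal entry of [A] in the eigenbasis of [B] is a sum of nonnegative terms bounded
    by [mu j], so a single nonzero term forces [mu j > 0]. Hence every logarithm that carries a
    nonzero weight below has a positive argument. *)
Lemma overlap_supp n (A U B V : 'M[C]_n) lam mu i j :
  spectral_dec A U lam -> spectral_dec B V mu -> psdmx A -> psdmx (B - A) ->
  overlap U V i j * lam i != 0 -> 0 < lam i /\ 0 < mu j.
Proof.
move=> sA sB pA pBA; rewrite mulf_eq0 negb_or => /andP[w0 l0].
have lpos : 0 < lam i by rewrite lt_def l0 (spectral_dec_ge0 _ pA sA).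
split=> //; have wpos : 0 < overlap U V i j by rewrite lt_def w0 overlap_ge0.
have : (\sum_i overlap U V i j * lam i)%:C <= (mu j)%:C.
  rewrite -(spectral_dec_overlap V j sA) -(spectral_dec_eig j sB) -subr_ge0.
  have := psdmx_diag_ge0 V j pBA.
  by rewrite mulmxBr mulmxBl mxE [X in _ + X]mxE.
rewrite lecR; apply: lt_le_trans.
rewrite (bigD1 i) //= ltr_pwDl ?mulr_gt0 // sumr_ge0 // => k _.
by rewrite mulr_ge0 ?overlap_ge0 // (spectral_dec_ge0 _ pA sA).
Qed.

(** * Variational formula for the derivative of the relative entropy *)

(** For [a = 1 - r] and [b = r] this is the functional whose supremum over [X] is [Phi_r(A,B)]. *)
Definition trvar n (A B : 'M[C]_n) (a b : R) (X : 'M[C]_n) : C :=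
  \tr (X^t* *m A) + (\tr (X^t* *m A))^* - a%:C * \tr (X^t* *m B *m X)
  - b%:C * \tr (X *m A *m X^t*).

(** Closed form of that supremum. When [b > 0] and the spectra are nonnegative, a zero denominator
    occurs only with [lam i = 0], where the quotient is 0 as it should be. *)
Definition trphi n (U : 'M[C]_n) lam V mu (a b : R) : R :=
  \sum_i \sum_j overlap U V i j * (lam i ^+ 2 / (a * mu j + b * lam i)).

Lemma trvarD n (A A' B B' : 'M[C]_n) a b X :
  trvar (A + A') (B + B') a b X = trvar A B a b X + trvar A' B' a b X.
Proof.
rewrite /trvar !mulmxDr !mulmxDl !mxtraceD rmorphD; ring.
Qed.

Lemma mxtrace_unitary_conj n (U M : 'M[C]_n) : U \is unitarymx ->
  \tr (U^t* *m M *m U) = \tr M.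
Proof.
by move=> Uu; rewrite mxtrace_mulC mulmxA (unitarymxP Uu) mul1mx.
Qed.

(** Writing [X] in the two eigenbases decouples the functional into one scalar quadratic for each
    entry of [x]. *)
Lemma trvar_spectral n (A B U V : 'M[C]_n) lam mu a b x :
  spectral_dec A U lam -> spectral_dec B V mu ->
  trvar A B a b (V^t* *m x *m U) =
  \sum_i \sum_j ((x j i)^* * (V *m U^t*) j i * (lam i)%:C
    + ((x j i)^* * (V *m U^t*) j i * (lam i)%:C)^*
    - (a * mu j + b * lam i)%:C * (x j i * (x j i)^*)).
Proof.
move=> [Uu ->] [Vu ->]; rewrite /trvar.
have -> : \tr ((V^t* *m x *m U)^t* *m (U^t* *m rdiag lam *m U)) =
   \sum_i \sum_j (x j i)^* * (V *m U^t*) j i * (lam i)%:C.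
  rewrite !adjmxM trmxCK.
  have -> : U^t* *m (x^t* *m V) *m (U^t* *m rdiag lam *m U) =
            U^t* *m (x^t* *m (V *m U^t*) *m rdiag lam) *m U.
    by rewrite !mulmxA.
  rewrite mxtrace_unitary_conj // /mxtrace; apply: eq_bigr => i _.
  rewrite mul_mx_diag mxE [X in X * _]mxE mulr_suml.
  by apply: eq_bigr => j _; rewrite !mxE.
have -> : \tr ((V^t* *m x *m U)^t* *m (V^t* *m rdiag mu *m V) *m
               (V^t* *m x *m U)) =
   \sum_i \sum_j (mu j)%:C * (x j i * (x j i)^*).
  rewrite !adjmxM trmxCK !mulmxA !(mulmxtVK _ Vu).
  have -> : U^t* *m x^t* *m rdiag mu *m x *m U =
            U^t* *m (x^t* *m (rdiag mu *m x)) *m U by rewrite !mulmxA.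
  rewrite mxtrace_unitary_conj // /mxtrace; apply: eq_bigr => i _.
  rewrite mul_diag_mx mxE; apply: eq_bigr => j _.
  by rewrite !mxE /=; ring.
have -> : \tr (V^t* *m x *m U *m (U^t* *m rdiag lam *m U) *m
               (V^t* *m x *m U)^t*) =
   \sum_i \sum_j (lam i)%:C * (x j i * (x j i)^*).
  rewrite !adjmxM trmxCK !mulmxA !(mulmxtVK _ Uu).
  have -> : V^t* *m x *m rdiag lam *m x^t* *m V =
            V^t* *m (x *m rdiag lam *m x^t*) *m V by rewrite !mulmxA.
  rewrite mxtrace_unitary_conj // exchange_big /mxtrace; apply: eq_bigr => j _ /=.
  rewrite mul_mx_diag mxE; apply: eq_bigr => i _.
  by rewrite !mxE /=; ring.
rewrite rmorph_sum !mulr_sumr -big_split -!sumrB; apply: eq_bigr => i _ /=.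
rewrite rmorph_sum !mulr_sumr -big_split -!sumrB; apply: eq_bigr => j _ /=.
rewrite rmorphD !rmorphM /=; ring.
Qed.

(** For [D > 0] the gap between the two sides is [|m l - D x|^2 / D]; for [D = 0] both sides vanish.
    The next lemma takes the [x] that closes the gap. *)
Lemma complete_square_le (x m : C) (l D : R) : 0 <= D -> (D = 0 -> l = 0) ->
  x^* * m * l%:C + (x^* * m * l%:C)^* - D%:C * (x * x^*) <=
  m * m^* * (l ^+ 2 / D)%:C.
Proof.
move=> D0 Dl; have [/[dup] E /Dl ->|DN] := eqVneq D 0.
  have -> : (0 ^+ 2 / D)%:C = 0 by rewrite expr0n /= mul0r.
  have -> : (0 : R)%:C = 0 by []; have -> : D%:C = 0 by rewrite E.
  by rewrite !mulr0 rmorph0 mul0r addr0 subr0 lexx.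
rewrite -subr_ge0.
have -> : m * m^* * (l ^+ 2 / D)%:C -
   (x^* * m * l%:C + (x^* * m * l%:C)^* - D%:C * (x * x^*)) =
   (m * l%:C - D%:C * x) * (m * l%:C - D%:C * x)^* / D%:C.
  rewrite !rmorphB !rmorphM /= !conjCR conjCK fmorphV /=.
  field.
  by rewrite -[0]/(0%:C) (inj_eq (@complexI _)).
by rewrite mulr_ge0 ?mul_conjC_ge0 // invr_ge0 ler0c.
Qed.

Lemma complete_square_eq (m : C) (l D : R) : (D = 0 -> l = 0) ->
  let x := m * (l / D)%:C in
  x^* * m * l%:C + (x^* * m * l%:C)^* - D%:C * (x * x^*) =
  m * m^* * (l ^+ 2 / D)%:C.
Proof.
move=> Dl x; rewrite {}/x; have [/[dup] E /Dl ->|DN] := eqVneq D 0.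
  have -> : (0 ^+ 2 / D)%:C = 0 by rewrite expr0n /= mul0r.
  have -> : (0 : R)%:C = 0 by []; have -> : D%:C = 0 by rewrite E.
  by rewrite !mulr0 rmorph0 mul0r addr0 subr0.
rewrite !rmorphM /= !conjCR conjCK.
have -> : (D^-1)%:C = D%:C^-1 by rewrite fmorphV.
field.
by rewrite -[0]/(0%:C) (inj_eq (@complexI _)).
Qed.

Section Phi.
Variables (n : nat) (A B U V : 'M[C]_n) (lam mu : 'I_n -> R) (a b : R).
Hypotheses (sA : spectral_dec A U lam) (sB : spectral_dec B V mu).
Hypotheses (lam0 : forall i, 0 <= lam i) (mu0 : forall i, 0 <= mu i).
Hypotheses (a0 : 0 <= a) (b0 : 0 < b).

Let den_ge0 i j : 0 <= a * mu j + b * lam i.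
Proof. by rewrite addr_ge0 // mulr_ge0 // ltW. Qed.

Let den_eq0 i j : a * mu j + b * lam i = 0 -> lam i = 0.
Proof.
move/eqP; rewrite paddr_eq0 ?mulr_ge0 // ?(ltW b0) //.
by rewrite !mulf_eq0 (gt_eqF b0) => /andP[_ /eqP].
Qed.

Lemma trvar_le_phi X : trvar A B a b X <= (trphi U lam V mu a b)%:C.
Proof.
have [Uu _] := sA; have [Vu _] := sB.
have VV : V^t* *m V = 1%:M.
  by move: Vu; rewrite -trmxC_unitary => /unitarymxP; rewrite trmxCK.
have UU : U^t* *m U = 1%:M.
  by move: Uu; rewrite -trmxC_unitary => /unitarymxP; rewrite trmxCK.
have -> : X = V^t* *m (V *m X *m U^t*) *m U.
  by rewrite !mulmxA VV mul1mx -mulmxA UU mulmx1.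
rewrite (trvar_spectral _ _ _ sA sB) /trphi rmorph_sum ler_sum // => i _.
rewrite rmorph_sum ler_sum // => j _; rewrite [leRHS]rmorphM /= overlapE.
exact/complete_square_le/den_eq0.
Qed.

Lemma trvar_eq_phi : exists X, trvar A B a b X = (trphi U lam V mu a b)%:C.
Proof.
exists (V^t* *m (\matrix_(j, i)
  ((V *m U^t*) j i * (lam i / (a * mu j + b * lam i))%:C)) *m U).
rewrite (trvar_spectral _ _ _ sA sB) /trphi rmorph_sum; apply: eq_bigr => i _.
rewrite rmorph_sum; apply: eq_bigr => j _; rewrite [RHS]rmorphM /= overlapE mxE.
exact/complete_square_eq/den_eq0.
Qed.
End Phi.

(** An [X] optimal for the summed pair is merely admissible for each of the two pairs, and [trvar]
    is additive in the pair. *)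
Lemma trphi_subadd n (A B U V A' B' U' V' UC VC : 'M[C]_n)
    lam mu lam' mu' lamC muC (a b : R) :
  spectral_dec A U lam -> spectral_dec B V mu ->
  spectral_dec A' U' lam' -> spectral_dec B' V' mu' ->
  spectral_dec (A + A') UC lamC -> spectral_dec (B + B') VC muC ->
  psdmx A -> psdmx B -> psdmx A' -> psdmx B' -> 0 <= a -> 0 < b ->
  trphi UC lamC VC muC a b <= trphi U lam V mu a b + trphi U' lam' V' mu' a b.
Proof.
move=> sA sB sA' sB' sAA sBB pA pB pA' pB' a0 b0.
have pAA := psdmxD pA pA'; have pBB := psdmxD pB pB'.
have nn n0 (M W : 'M[C]_n0) l (p : psdmx M) (s : spectral_dec M W l) i :
  0 <= l i := spectral_dec_ge0 i p s.
have [X EX] := trvar_eq_phi sAA sBB (nn _ _ _ _ pAA sAA) (nn _ _ _ _ pBB sBB)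
                a0 b0.
rewrite -lecR rmorphD /= -EX trvarD lerD //.
  exact: (trvar_le_phi sA sB (nn _ _ _ _ pA sA) (nn _ _ _ _ pB sB)).
exact: (trvar_le_phi sA' sB' (nn _ _ _ _ pA' sA') (nn _ _ _ _ pB' sB')).
Qed.

(** * Joint subadditivity of relative entropy *)

Lemma derivable_pt_lim_sum (I : Type) (s : seq I) (F : I -> R -> R) F' x :
  (forall i, derivable_pt_lim (F i) x (F' i)) ->
  derivable_pt_lim (fun r => \sum_(i <- s) F i r) x (\sum_(i <- s) F' i).
Proof.
move=> dF; elim: s => [|i s IH].
  rewrite big_nil (_ : (fun _ => _) = fct_cte 0); last first.
    by apply: boolp.funext => r; rewrite big_nil.
  exact: derivable_pt_lim_const.
rewrite big_cons (_ : (fun _ => _) =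
    plus_fct (F i) (fun r => \sum_(i <- s) F i r)); last first.
  by apply: boolp.funext => r; rewrite big_cons.
exact: derivable_pt_lim_plus.
Qed.

Lemma segment_gt0 (l m r : R) : 0 < l -> 0 < m -> 0 <= r <= 1 ->
  0 < (1 - r) * m + r * l.
Proof.
move=> l0 m0 /andP[r0 r1]; have [r1'|r1'] := ltrP r 1.
  by rewrite ltr_pwDl ?mulr_gt0 ?subr_gt0 // mulr_ge0 // ltW.
have -> : r = 1 by lra.
by lra.
Qed.

(** Where the weight [c] vanishes the argument of [ln] may fail to be positive, but the function is
    then constantly 0. *)
Lemma derivable_ln_segment (c l m r : R) : (c != 0 -> 0 < l /\ 0 < m) ->
  0 <= r <= 1 ->
  derivable_pt_lim (fun r => c * ln ((1 - r) * m + r * l)) r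
    (c * ((l - m) / ((1 - r) * m + r * l))).
Proof.
move=> supp /andP[r0 r1]; have [->|/supp[l0 m0]] := eqVneq c 0.
  rewrite mul0r (_ : (fun _ => _) = fct_cte 0); last first.
    by apply: boolp.funext => s; rewrite mul0r.
  exact: derivable_pt_lim_const.
apply: (derivable_pt_lim_scal (fun r => ln ((1 - r) * m + r * l))).
rewrite mulrC; apply: (derivable_pt_lim_comp (fun r => (1 - r) * m + r * l) ln).
  rewrite (_ : (fun _ => _) = plus_fct (fct_cte m) (mult_real_fct (l - m) id));
    last first.
    apply: boolp.funext => s.
    rewrite /plus_fct /fct_cte /mult_real_fct /id RplusE RmultE RminusE; ring.
  have := derivable_pt_lim_plus _ _ r _ _ (derivable_pt_lim_const m r)
    (derivable_pt_lim_scal _ (l - m) _ _ (derivable_pt_lim_id r)).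
  by rewrite RplusE RmultE RminusE mulr1 add0r.
apply: derivable_pt_lim_ln; apply/RltP.
by rewrite segment_gt0 ?r0.
Qed.

(** Under [supp_incl] this is [D(A||B) = tr A (ln A - ln B)], in natural units, expressed through
    the spectra and overlaps. *)
Definition relent n (U : 'M[C]_n) (lam : 'I_n -> R) V (mu : 'I_n -> R) : R :=
  \sum_i \sum_j overlap U V i j * lam i * (ln (lam i) - ln (mu j)).

Definition supp_incl n (U : 'M[C]_n) (lam : 'I_n -> R) V (mu : 'I_n -> R) :=
  forall i j, overlap U V i j * lam i != 0 -> 0 < lam i /\ 0 < mu j.

Definition logsegment n (U : 'M[C]_n) (lam : 'I_n -> R) V (mu : 'I_n -> R) r : R :=
  \sum_i \sum_j overlap U V i j * lam i * ln ((1 - r) * mu j + r * lam i).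

Definition dlogsegment n (U : 'M[C]_n) (lam : 'I_n -> R) V (mu : 'I_n -> R) r : R :=
  \sum_i \sum_j overlap U V i j * lam i *
    ((lam i - mu j) / ((1 - r) * mu j + r * lam i)).

Section LogSegment.
Variables (n : nat) (U V : 'M[C]_n) (lam mu : 'I_n -> R).

Lemma relent_logsegment : relent U lam V mu =
  logsegment U lam V mu 1 - logsegment U lam V mu 0.
Proof.
rewrite /relent /logsegment -sumrB; apply: eq_bigr => i _.
rewrite -sumrB; apply: eq_bigr => j _.
by rewrite subrr subr0 !mul0r !mul1r add0r addr0 mulrBr.
Qed.

Hypothesis supp : supp_incl U lam V mu.

Lemma derivable_logsegment r : 0 <= r <= 1 ->
  derivable_pt_lim (logsegment U lam V mu) r (dlogsegment U lam V mu r).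
Proof.
move=> r01; apply: derivable_pt_lim_sum => i; apply: derivable_pt_lim_sum => j.
exact: derivable_ln_segment (@supp i j) r01.
Qed.

(** With [D = (1 - r) mu + r lam], each term satisfies [(1 - r) lam (lam - mu) / D = lam^2 / D -
    lam]; the overlaps sum to 1 over [j], which leaves the trace of [A]. *)
Lemma dlogsegment_phi r : U \is unitarymx -> V \is unitarymx -> 0 < r < 1 ->
  (1 - r) * dlogsegment U lam V mu r =
  trphi U lam V mu (1 - r) r - \sum_i lam i.
Proof.
move=> Uu Vu /andP[r0 r1]; rewrite /trphi /dlogsegment mulr_sumr -sumrB.
apply: eq_bigr => i _.
have S : \sum_j overlap U V i j * lam i = lam i.
  by rewrite -mulr_suml overlap_sumr // mul1r.
rewrite mulr_sumr -[X in _ = _ - X]S -sumrB; apply: eq_bigr => j _.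
have [E|N] := eqVneq (overlap U V i j * lam i) 0.
  by rewrite E mul0r mulr0 expr2 -!mulrA mulrA E mul0r subr0.
have [l0 m0] := supp N.
have D : (1 - r) * mu j + r * lam i != 0 by rewrite lt0r_neq0 // segment_gt0 ?ltW.
by field.
Qed.
End LogSegment.

Lemma relent_subadd n (A B U V A' B' U' V' UC VC : 'M[C]_n)
    lam mu lam' mu' lamC muC :
  spectral_dec A U lam -> spectral_dec B V mu ->
  spectral_dec A' U' lam' -> spectral_dec B' V' mu' ->
  spectral_dec (A + A') UC lamC -> spectral_dec (B + B') VC muC ->
  psdmx A -> psdmx (B - A) -> psdmx A' -> psdmx (B' - A') ->
  relent UC lamC VC muC <= relent U lam V mu + relent U' lam' V' mu'.
Proof.
move=> sA sB sA' sB' sAA sBB pA pBA pA' pBA'.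
have pB : psdmx B by have := psdmxD pBA pA; rewrite subrK.
have pB' : psdmx B' by have := psdmxD pBA' pA'; rewrite subrK.
have pAA := psdmxD pA pA'; have pBB := psdmxD pB pB'.
have pBAA : psdmx (B + B' - (A + A')) 
  by have := psdmxD pBA pBA'; rewrite addrACA -opprD.
have supp i j := @overlap_supp n _ _ _ _ _ _ i j sA sB pA pBA.
have supp' i j := @overlap_supp n _ _ _ _ _ _ i j sA' sB' pA' pBA'.
have suppC i j := @overlap_supp n _ _ _ _ _ _ i j sAA sBB pAA pBAA.
pose K := (logsegment U lam V mu + logsegment U' lam' V' mu' -
           logsegment UC lamC VC muC)%F.
pose K' r := dlogsegment U lam V mu r + dlogsegment U' lam' V' mu' r -
           dlogsegment UC lamC VC muC r.
have dK c : Rle 0 c /\ Rle c 1 -> derivable_pt_lim K c (K' c).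
  case=> /RleP c0 /RleP c1; have c01 : 0 <= c <= 1 by rewrite c0.
  apply: derivable_pt_lim_minus; last exact: derivable_logsegment.
  by apply: derivable_pt_lim_plus; exact: derivable_logsegment.
have [c [+ [/RltP c0 /RltP c1]]] := MVT_cor2 K K' 0 1 Rlt_0_1 dK.
rewrite -subr_ge0 !relent_logsegment /K /minus_fct /plus_fct.
rewrite !RminusE !RplusE RmultE subr0 mulr1 => E.
have -> : logsegment U lam V mu 1 - logsegment U lam V mu 0 +
   (logsegment U' lam' V' mu' 1 - logsegment U' lam' V' mu' 0) -
   (logsegment UC lamC VC muC 1 - logsegment UC lamC VC muC 0) = K' c.
  rewrite -E; ring.
have c01 : 0 < c < 1 by rewrite c0.
(* Multiplying by [1 - c > 0] turns each derivative into [trphi] minus a trace. The traces cancel by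
   additivity, leaving [trphi_subadd]. *)
rewrite -(pmulr_rge0 _ (_ : 0 < 1 - c)) ?subr_gt0 // /K'.
have [[Uu _] [Vu _]] := (sA, sB); have [[Uu' _] [Vu' _]] := (sA', sB').
have [[UuC _] [VuC _]] := (sAA, sBB).
rewrite mulrBr mulrDr !dlogsegment_phi //.
have tr : \sum_i lamC i = \sum_i lam i + \sum_i lam' i.
  apply: complexI; rewrite rmorphD /= -(spectral_dec_trace sA).
  by rewrite -(spectral_dec_trace sA') -(spectral_dec_trace sAA) mxtraceD.
have c1' : 0 <= 1 - c by rewrite subr_ge0 ltW.
have := trphi_subadd sA sB sA' sB' sAA sBB pA pB pA' pB' c1' c0.
rewrite tr; lra.
Qed.

(** Klein's inequality: [ln y <= y - 1] at [y = mu j / (x * lam i)], averaged with the weights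
    [overlap * lam i]. The free scale [x] lets traces differ; each application takes
    [x = tr B / tr A]. *)
Lemma relent_klein n (A B U V : 'M[C]_n) lam mu x :
  spectral_dec A U lam -> spectral_dec B V mu -> psdmx A -> psdmx B ->
  supp_incl U lam V mu -> 0 < x ->
  (\sum_i lam i) * (1 - ln x) - (\sum_j mu j) / x <= relent U lam V mu.
Proof.
move=> sA sB pA pB supp x0.
have [Uu _] := sA; have [Vu _] := sB.
have -> : \sum_j mu j = \sum_i \sum_j overlap U V i j * mu j.
  rewrite exchange_big; apply: eq_bigr => j _.
  by rewrite -mulr_suml overlap_suml // mul1r.
have -> : \sum_i lam i = \sum_i \sum_j overlap U V i j * lam i.
  by apply: eq_bigr => i _; rewrite -mulr_suml overlap_sumr // mul1r.
rewrite !mulr_suml -sumrB ler_sum // => i _.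
rewrite !mulr_suml -sumrB ler_sum // => j _.
have w0 := overlap_ge0 U V i j.
have m0 : 0 <= mu j := spectral_dec_ge0 j pB sB.
have [E|N] := eqVneq (overlap U V i j * lam i) 0.
  by rewrite E !mul0r sub0r oppr_le0 divr_ge0 ?mulr_ge0 ?(ltW x0).
have [l0 {}m0] := supp _ _ N.
rewrite -!mulrA -mulrBr ler_wpM2l //.
have lnle : ln (mu j / (x * lam i)) <= mu j / (x * lam i) - 1.
  have y0 : 0 < mu j / (x * lam i) by rewrite divr_gt0 ?mulr_gt0.
  have /RleP := exp_ineq1_le (ln (mu j / (x * lam i))).
  rewrite exp_ln; last exact/RltP.
  by rewrite lerBrDl.
have xl0 : 0 < x * lam i by rewrite mulr_gt0.
have lnE : ln (mu j / (x * lam i)) = ln (mu j) - (ln x + ln (lam i)).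
  rewrite [LHS]ln_mult; [|exact/RltP|by apply/RltP; rewrite invr_gt0].
  rewrite [X in Rplus _ X]ln_Rinv; last exact/RltP.
  by rewrite [ln (x * _)]ln_mult //; exact/RltP.
rewrite lnE in lnle.
rewrite [X in _ - X](_ : _ = lam i * (mu j / (x * lam i))); last first.
  by field; rewrite !lt0r_neq0.
rewrite -mulrBr ler_wpM2l ?(ltW l0) //; lra.
Qed.

(** * Von Neumann entropy *)

Lemma ln2_gt0 : 0 < ln 2.
Proof.
have := ln_increasing _ _ Rlt_0_1 (_ : Rlt 1 (1 + 1)).
by rewrite ln_1 => H; apply/RltP/H/RltP; lra.
Qed.

Lemma etaR_ln2 (x : R) : 0 <= x -> etaR x * ln 2 = - (x * ln x).
Proof.
move=> x0; rewrite /etaR; case: Rlt_dec => x1 /=.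
  rewrite RmultE RoppE RdivE mulNr mulNr; congr (- _).
  by rewrite -mulrA divfK // lt0r_neq0 // ln2_gt0.
have -> : x = 0.
  by apply/eqP; rewrite eq_le x0 andbT leNgt; apply/negP => /RltP.
by rewrite !mul0r oppr0.
Qed.

Definition vent n (lam : 'I_n -> R) : R := \sum_i etaR (lam i).

Lemma relentE n (U V : 'M[C]_n) lam mu :
  U \is unitarymx -> V \is unitarymx -> (forall i, 0 <= lam i) ->
  relent U lam V mu = - (vent lam * ln 2) -
    \sum_j (\sum_i overlap U V i j * lam i) * ln (mu j).
Proof.
move=> Uu Vu lam0; rewrite /vent mulr_suml.
rewrite (eq_bigr (fun i => - (lam i * ln (lam i)))); last first.
  by move=> i _; rewrite etaR_ln2.
under [X in _ = _ - X]eq_bigr do rewrite mulr_suml.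
rewrite [X in _ = _ - X]exchange_big sumrN opprK -sumrB.
apply: eq_bigr => i _.
have S : \sum_j overlap U V i j * (lam i * ln (lam i)) = lam i * ln (lam i).
  by rewrite -mulr_suml overlap_sumr // mul1r.
rewrite -[X in _ = X - _]S -sumrB; apply: eq_bigr => j _; ring.
Qed.

Lemma relent_self n (A U : 'M[C]_n) lam : psdmx A -> spectral_dec A U lam ->
  relent U lam U lam = 0.
Proof.
move=> pA sA; have [Uu _] := sA; have l0 i := spectral_dec_ge0 i pA sA.
rewrite relentE // /vent mulr_suml -opprD -big_split /=; apply/eqP.
rewrite oppr_eq0; apply/eqP; apply: big1 => i _.
rewrite etaR_ln2 //; suff -> : \sum_k overlap U U k i * lam k = lam i by rewrite addNr.
apply: complexI.
by rewrite -(spectral_dec_overlap U i sA) (spectral_dec_eig i sA).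
Qed.

Lemma spectral_dec0 n : @spectral_dec n 0 1%:M (fun=> 0).
Proof.
split; first by apply/unitarymxP; rewrite trmx1 map_mx1 mulmx1.
have -> : rdiag (fun=> 0) = 0 :> 'M[C]_n.
  by apply/matrixP => i j; rewrite !mxE mul0rn.
by rewrite mulmx0 mul0mx.
Qed.

Lemma relent0 n (U V : 'M[C]_n) mu : relent U (fun=> 0) V mu = 0.
Proof. by apply: big1 => i _; apply: big1 => j _; rewrite mulr0 mul0r. Qed.

Lemma psdmx0 n : psdmx (0 : 'M[C]_n).
Proof.
split=> [|x]; first by rewrite trmx0 map_mx0.
by rewrite mulmx0 mul0mx mxE.
Qed.

(** Split the pair [(A, B)] as [(A, A) + (0, B - A)]: by joint subadditivity its relative entropy is
    at most the sum of two vanishing ones. *)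
Lemma relent_le0 n (A U B V : 'M[C]_n) lam mu :
  spectral_dec A U lam -> spectral_dec B V mu -> psdmx A -> psdmx (B - A) ->
  relent U lam V mu <= 0.
Proof.
move=> sA sB pA pBA.
have [W [nu sD]] : exists W nu, spectral_dec (B - A) W nu.
  by apply: hermitian_spectral_dec; case: pBA.
have sA' : spectral_dec (A + 0) U lam by rewrite addr0.
have sB' : spectral_dec (A + (B - A)) V mu by rewrite addrC subrK.
have pAA : psdmx (A - A) by rewrite subrr; exact: psdmx0.
have pBA0 : psdmx (B - A - 0) by rewrite subr0.
have := relent_subadd sA sA (spectral_dec0 n) sD sA' sB' pA pAA (psdmx0 n) pBA0.
by rewrite (relent_self pA sA) relent0 addr0.
Qed.

Section EntropySum.
Variables (n : nat) (A B U V W : 'M[C]_n) (lam mu nu : 'I_n -> R).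
Hypotheses (pA : psdmx A) (pB : psdmx B) (sA : spectral_dec A U lam)
  (sB : spectral_dec B V mu) (sC : spectral_dec (A + B) W nu).

(** With [C = A + B], the cross terms [tr A ln C] and [tr B ln C] add up to [tr C ln C], which is
    the entropy of [C] up to sign and units. *)
Lemma relent_entropy_sum : relent U lam W nu + relent V mu W nu =
  (vent nu - vent lam - vent mu) * ln 2.
Proof.
have [Uu _] := sA; have [Vu _] := sB; have [Wu _] := sC.
rewrite !relentE //; [|by move=> i; exact: spectral_dec_ge0 pB sB|
  by move=> i; exact: spectral_dec_ge0 pA sA].
rewrite addrACA -opprD -[X in _ + X]opprD -big_split /=.
have -> : \sum_j ((\sum_i overlap U W i j * lam i) * ln (nu j) +
   (\sum_i overlap V W i j * mu i) * ln (nu j)) = - (vent nu * ln 2).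
  rewrite /vent mulr_suml -sumrN; apply: eq_bigr => j _.
  rewrite etaR_ln2 ?(spectral_dec_ge0 _ (psdmxD pA pB) sC) // opprK -mulrDl.
  congr (_ * _); apply: complexI; rewrite rmorphD /=.
  rewrite -(spectral_dec_overlap W j sA) -(spectral_dec_overlap W j sB).
  by rewrite -(spectral_dec_eig j sC) mulmxDr mulmxDl [RHS]mxE.
ring.
Qed.

Lemma vent_subadd : vent nu <= vent lam + vent mu.
Proof.
rewrite -subr_le0 opprD addrA -(pmulr_rle0 _ ln2_gt0) mulrC.
rewrite -relent_entropy_sum.
have H1 : relent U lam W nu <= 0.
  by apply: (relent_le0 sA sC) => //; rewrite addrC addKr.
have H2 : relent V mu W nu <= 0.
  by apply: (relent_le0 sB sC) => //; rewrite addrK.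
lra.
Qed.

(** Klein's inequality for [A] and [B] against [A + B] bounds the two relative entropies below by
    [- ln (1 + t)] and [t ln t - t ln (1 + t)]. Their sum is the mixing entropy of the weights
    [1 / (1 + t)] and [t / (1 + t)], scaled by [- (1 + t) ln 2]. *)
Lemma vent_mix t : \sum_i lam i = 1 -> \sum_i mu i = t ->
  vent lam + vent mu <= vent nu + (1 + t) * binH (t / (1 + t)).
Proof.
move=> trA trB.
have l0 i := spectral_dec_ge0 i pA sA.
have m0 i := spectral_dec_ge0 i pB sB.
have pC := psdmxD pA pB.
have trC : \sum_i nu i = 1 + t.
  apply: complexI; rewrite -(spectral_dec_trace sC) mxtraceD.
  by rewrite (spectral_dec_trace sA) (spectral_dec_trace sB) trA trB rmorphD.
have t0 : 0 <= t by rewrite -trB sumr_ge0.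
have t1 : 0 < 1 + t by lra.
have suppA : supp_incl U lam W nu.
  by move=> i j; apply: (overlap_supp sA sC) => //; rewrite addrC addKr.
have suppB : supp_incl V mu W nu.
  by move=> i j; apply: (overlap_supp sB sC) => //; rewrite addrK.
have KA := relent_klein sA sC pA pC suppA t1.
rewrite trA trC mul1r divff ?lt0r_neq0 // in KA.
have KB : t * ln t - t * ln (1 + t) <= relent V mu W nu.
  (* The scale [(1 + t) / t] makes no sense at [t = 0]; there the spectrum [mu] is identically 0 and
     both sides vanish. *)
  have [tz|tn] := eqVneq t 0.
    rewrite tz !mul0r subrr.
    have mz i : mu i = 0.
      apply/eqP; rewrite eq_le m0 andbT -tz -trB (bigD1 i) //= lerDl.
      by rewrite sumr_ge0.
    rewrite /relent; rewrite big1 // => i _; rewrite big1 // => j _.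
    by rewrite mz mulr0 mul0r.
  have tp : 0 < t by rewrite lt_def tn.
  have x0 : 0 < (1 + t) / t by rewrite divr_gt0.
  have := relent_klein sB sC pB pC suppB x0.
  rewrite trB trC invf_div mulrCA divff ?lt0r_neq0 // mulr1.
  rewrite [ln (_ / _)]ln_mult; [|exact/RltP|by apply/RltP; rewrite invr_gt0].
  rewrite [ln (_^-1)]ln_Rinv; last exact/RltP.
  by rewrite RplusE RoppE; lra.
have H : (1 + t) * binH (t / (1 + t)) * ln 2 =
   (1 + t) * ln (1 + t) - t * ln t.
  have p0 : 0 <= t / (1 + t) by rewrite divr_ge0 // ltW.
  have E : Rminus 1 (t / (1 + t)) = (1 + t)^-1.
    rewrite RminusE; field; exact: lt0r_neq0.
  rewrite /binH E RplusE -mulrA [X in _ * X]mulrDl !etaR_ln2 ?invr_ge0 ?(ltW t1) //.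
  rewrite [ln (_^-1)]ln_Rinv; last exact/RltP.
  have [tz|tn] := eqVneq t 0.
    rewrite tz !mul0r addr0 [X in Ropp X](_ : _ = 0); last first.
      exact: ln_1.
    by rewrite (_ : ln 1 = 0) ?RoppE; [ring | exact: ln_1].
  have tp : 0 < t by rewrite lt_def tn.
  rewrite [ln (_ / _)]ln_mult; [|exact/RltP|by apply/RltP; rewrite invr_gt0].
  rewrite [ln (_^-1)]ln_Rinv; last exact/RltP.
  by rewrite RplusE RoppE; field; exact: lt0r_neq0.
rewrite -(ler_pM2r ln2_gt0) mulrDl [leRHS]mulrDl H.
have := relent_entropy_sum; lra.
Qed.
End EntropySum.

(** * Conditional entropy of classical-quantum states *)

Definition cqmx n (A0 A1 : 'M[C]_n) : 'M[C]_(n + n) := block_mx A0 0 0 A1.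

Definition cqdup n (mu : 'I_n -> R) (i : 'I_(n + n)) : R :=
  match split i with inl j => mu j | inr j => mu j end.

(** Conditional entropy, in bits, of the possibly unnormalised cq-state with conditional blocks [A0]
    and [A1]; a relation, because the decompositions are not canonical. *)
Definition condent n (A0 A1 : 'M[C]_n) (s : R) : Prop :=
  exists U lam V mu, [/\ spectral_dec (cqmx A0 A1) U lam,
    spectral_dec (A0 + A1) V mu & s = vent lam - vent mu].

Lemma adj_cqmx n (A0 A1 : 'M[C]_n) : (cqmx A0 A1)^t* = cqmx (A0^t*) (A1^t*).
Proof. by rewrite /cqmx tr_block_mx map_block_mx !trmx0 !map_mx0. Qed.

Lemma mul_cqmx n (A0 A1 B0 B1 : 'M[C]_n) :
  cqmx A0 A1 *m cqmx B0 B1 = cqmx (A0 *m B0) (A1 *m B1).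
Proof. by rewrite /cqmx mulmx_block !mulmx0 !mul0mx !addr0 !add0r. Qed.

Lemma cqmxD n (A0 A1 B0 B1 : 'M[C]_n) :
  cqmx A0 A1 + cqmx B0 B1 = cqmx (A0 + B0) (A1 + B1).
Proof. by rewrite /cqmx add_block_mx !addr0. Qed.

Lemma cqmxB n (A0 A1 B0 B1 : 'M[C]_n) :
  cqmx A0 A1 - cqmx B0 B1 = cqmx (A0 - B0) (A1 - B1).
Proof. by rewrite /cqmx opp_block_mx add_block_mx !subr0. Qed.

Lemma psdmx_cq n (A0 A1 : 'M[C]_n) : psdmx A0 -> psdmx A1 ->
  psdmx (cqmx A0 A1).
Proof.
move=> [h0 p0] [h1 p1]; split=> [|x]; first by rewrite adj_cqmx h0 h1.
rewrite -[x]hsubmxK mul_row_block !mulmx0 addr0 add0r tr_row_mx map_col_mx.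
by rewrite mul_row_col mxE addr_ge0.
Qed.

Lemma spectral_dec_cqdup n (B V : 'M[C]_n) mu : spectral_dec B V mu ->
  spectral_dec (cqmx B B) (cqmx V V) (cqdup mu).
Proof.
case=> Vu ->; split.
  apply/unitarymxP; rewrite adj_cqmx mul_cqmx (unitarymxP Vu).
  by rewrite /cqmx -scalar_mx_block.
rewrite adj_cqmx.
have -> : rdiag (cqdup mu) = cqmx (rdiag mu) (rdiag mu).
  rewrite /cqmx /rdiag -diag_mx_row.
  congr diag_mx; apply/rowP => i; rewrite !mxE /cqdup.
  by case: split => j; rewrite mxE.
by rewrite !mul_cqmx.
Qed.

Lemma sum_cqdup n (mu : 'I_n -> R) : \sum_i cqdup mu i = 2 * \sum_i mu i.
Proof.
rewrite big_split_ord /= mulr2n mulrDl !mul1r; congr (_ + _).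
  by apply: eq_bigr => i _; rewrite /cqdup (unsplitK (inl i)).
by apply: eq_bigr => i _; rewrite /cqdup (unsplitK (inr i)).
Qed.

Section CondEntropy.
Variables (n : nat) (A0 A1 V : 'M[C]_n) (U : 'M[C]_(n + n)).
Variables (lam : 'I_(n + n) -> R) (mu : 'I_n -> R).
Hypotheses (p0 : psdmx A0) (p1 : psdmx A1).
Hypotheses (sZE : spectral_dec (cqmx A0 A1) U lam)
  (sE : spectral_dec (A0 + A1) V mu).

(** The difference is the block-diagonal matrix of [A1] and [A0]. This domination of [rho_ZE] by
    [1 (x) rho_E] makes classical conditional entropy nonnegative. *)
Lemma psdmx_cqdup_sub : psdmx (cqmx (A0 + A1) (A0 + A1) - cqmx A0 A1).
Proof. by rewrite cqmxB addrK addrC addrA addNr add0r; exact: psdmx_cq. Qed.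

(** In the eigenbasis of [rho_E], the diagonals of the two blocks add up to [mu], so the cross term
    of [relentE] reduces to the entropy of [rho_E]. *)
Lemma relent_condent : relent U lam (cqmx V V) (cqdup mu) =
  - ((vent lam - vent mu) * ln 2).
Proof.
have [Uu _] := sZE; have [VVu _] := spectral_dec_cqdup sE.
rewrite relentE //; last first.
  by move=> i; exact: spectral_dec_ge0 (psdmx_cq p0 p1) sZE.
rewrite mulrBl opprB addrC; congr (_ - _).
rewrite big_split_ord /= -big_split /= /vent mulr_suml -sumrN.
apply: eq_bigr => j _.
rewrite etaR_ln2 ?(spectral_dec_ge0 _ (psdmxD p0 p1) sE) // /cqdup.
rewrite (unsplitK (inl j)) (unsplitK (inr j)) -mulrDl.
congr (- (_ * _)); apply: complexI; rewrite rmorphD /=.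
rewrite -!(spectral_dec_overlap _ _ sZE) -(spectral_dec_eig j sE).
rewrite adj_cqmx !mul_cqmx /cqmx block_mxEul block_mxEdr.
by rewrite mulmxDr mulmxDl [RHS]mxE.
Qed.
End CondEntropy.

Lemma condent_exists n (A0 A1 : 'M[C]_n) : psdmx A0 -> psdmx A1 ->
  exists s, condent A0 A1 s.
Proof.
move=> p0 p1.
have [U [lam sU]] := hermitian_spectral_dec (psdmx_cq p0 p1).1.
have [V [mu sV]] := hermitian_spectral_dec (psdmxD p0 p1).1.
by exists (vent lam - vent mu), U, lam, V, mu.
Qed.

Section CondEntropyIneq.
Variables (n : nat) (A0 A1 : 'M[C]_n) (s : R).
Hypotheses (pA0 : psdmx A0) (pA1 : psdmx A1) (cA : condent A0 A1 s).

Lemma condent_ge0 : 0 <= s.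
Proof.
have [U [lam [V [mu [sU sV ->]]]]] := cA.
have := relent_le0 sU (spectral_dec_cqdup sV) (psdmx_cq pA0 pA1)
  (psdmx_cqdup_sub pA0 pA1).
by rewrite (relent_condent pA0 pA1 sU sV) oppr_le0 pmulr_lge0 // ln2_gt0.
Qed.

(** Klein's inequality at [x = 2], the ratio of the traces of [1 (x) rho_E] and [rho_ZE]: the
    measured system is a single bit. *)
Lemma condent_le_trace t : \tr (A0 + A1) = t%:C -> s <= t.
Proof.
move=> tr; have [U [lam [V [mu [sU sV ->]]]]] := cA.
have pcq := psdmx_cq pA0 pA1; have pB := psdmxD pA0 pA1.
have sVV := spectral_dec_cqdup sV.
have supp : supp_incl U lam (cqmx V V) (cqdup mu).
  by move=> i j; apply: (overlap_supp sU sVV pcq); exact: psdmx_cqdup_sub.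
have trB : \sum_i mu i = t by apply: complexI; rewrite -tr (spectral_dec_trace sV).
have trA : \sum_i lam i = t.
  apply: complexI; rewrite -tr -(spectral_dec_trace sU) mxtrace_block.
  by rewrite mxtraceD.
have := relent_klein sU sVV pcq (psdmx_cq pB pB) supp (_ : 0 < 2).
rewrite (relent_condent pA0 pA1 sU sV) trA sum_cqdup trB => /(_ (ltr0Sn _ _)).
by have := ln2_gt0; nra.
Qed.

(** Scaling adds to each entropy a multiple of [c ln c] times the trace; the two states have equal
    traces, so these terms cancel. *)
Lemma condent_scale (c : R) : 0 < c -> condent (c%:C *: A0) (c%:C *: A1) (c * s).
Proof.
move=> c0; have [U [lam [V [mu [sU sV sE]]]]] := cA.
have scale m (M W : 'M[C]_m) l : spectral_dec M W l ->
    spectral_dec (c%:C *: M) W (fun i => c * l i).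
  case=> Wu ->; split=> //; rewrite scalemxAl scalemxAr; congr (_ *m _ *m _).
  by apply/matrixP => i j; rewrite !mxE rmorphM /= mulrnAr.
have vscale m (l : 'I_m -> R) : (forall i, 0 <= l i) ->
    vent (fun i => c * l i) * ln 2 = c * (vent l * ln 2) - (\sum_i l i) * (c * ln c).
  move=> l0; rewrite /vent !mulr_suml mulr_sumr -sumrB; apply: eq_bigr => i _.
  rewrite !etaR_ln2 ?mulr_ge0 ?(ltW c0) //.
  have [->|N] := eqVneq (l i) 0; first by rewrite !(mulr0, mul0r, oppr0, addr0).
  have li0 : 0 < l i by rewrite lt_def N l0.
  rewrite [ln (c * _)]ln_mult; try exact/RltP.
  by rewrite RplusE; ring.
exists U, (fun i => c * lam i), V, (fun i => c * mu i); split.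
- by have := scale _ _ _ _ sU; rewrite /cqmx scale_block_mx !scaler0.
- by rewrite -scalerDr; exact: scale.
have tr : \sum_i lam i = \sum_i mu i.
  apply: complexI; rewrite -(spectral_dec_trace sU) -(spectral_dec_trace sV).
  by rewrite mxtrace_block mxtraceD.
have nzln : ln 2 != 0 by rewrite lt0r_neq0 // ln2_gt0.
apply: (mulIf nzln); rewrite mulrBl !vscale.
- by rewrite tr sE; ring.
- by move=> i; exact: spectral_dec_ge0 (psdmxD pA0 pA1) sV.
by move=> i; exact: spectral_dec_ge0 (psdmx_cq pA0 pA1) sU.
Qed.

Variables (B0 B1 : 'M[C]_n) (t r : R).
Hypotheses (pB0 : psdmx B0) (pB1 : psdmx B1) (cB : condent B0 B1 t).
Hypothesis cC : condent (A0 + B0) (A1 + B1) r.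

Lemma condent_superadd : s + t <= r.
Proof.
have [U [lam [V [mu [sU sV ->]]]]] := cA.
have [U' [lam' [V' [mu' [sU' sV' ->]]]]] := cB.
have [UC [lamC [VC [muC [sUC sVC ->]]]]] := cC.
have sVC' := spectral_dec_cqdup sVC.
have sUC' := sUC; rewrite -cqmxD in sUC'; rewrite addrACA -cqmxD in sVC'.
have := relent_subadd sU (spectral_dec_cqdup sV) sU' (spectral_dec_cqdup sV')
  sUC' sVC' (psdmx_cq pA0 pA1) (psdmx_cqdup_sub pA0 pA1)
  (psdmx_cq pB0 pB1) (psdmx_cqdup_sub pB0 pB1).
rewrite (relent_condent pA0 pA1 sU sV) (relent_condent pB0 pB1 sU' sV').
rewrite (relent_condent (psdmxD pA0 pB0) (psdmxD pA1 pB1) sUC sVC).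
by rewrite -opprD -mulrDl lerN2 ler_pM2r // ln2_gt0.
Qed.

(** The joint entropy is bounded by [vent_subadd], and the entropy of [E], which enters negatively,
    by [vent_mix]. *)
Lemma condent_add_le e : \tr (A0 + A1) = 1 -> \tr (B0 + B1) = e%:C ->
  r <= s + t + (1 + e) * binH (e / (1 + e)).
Proof.
move=> trA trB.
have [U [lam [V [mu [sU sV ->]]]]] := cA.
have [U' [lam' [V' [mu' [sU' sV' ->]]]]] := cB.
have [UC [lamC [VC [muC [sUC sVC ->]]]]] := cC.
rewrite -cqmxD in sUC; rewrite addrACA in sVC.
have H1 := vent_subadd (psdmx_cq pA0 pA1) (psdmx_cq pB0 pB1) sU sU' sUC.
have tr1 : \sum_i mu i = 1 by apply: complexI; rewrite -(spectral_dec_trace sV).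
have tr2 : \sum_i mu' i = e.
  by apply: complexI; rewrite -(spectral_dec_trace sV').
have H2 := vent_mix (psdmxD pA0 pA1) (psdmxD pB0 pB1) sV sV' sVC tr1 tr2.
lra.
Qed.
End CondEntropyIneq.

(** Adding [N] cannot lower the entropy of [A], while adding [P] raises that of [B] by at most the
    stated error; the two sums are the same state. *)
Lemma condent_continuity n (A0 A1 B0 B1 P0 P1 N0 N1 : 'M[C]_n) s t e :
  psdmx A0 -> psdmx A1 -> psdmx B0 -> psdmx B1 ->
  psdmx P0 -> psdmx P1 -> psdmx N0 -> psdmx N1 ->
  condent A0 A1 s -> condent B0 B1 t ->
  A0 + N0 = B0 + P0 -> A1 + N1 = B1 + P1 ->
  \tr (B0 + B1) = 1 -> \tr (P0 + P1) = e%:C ->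
  s <= t + e + (1 + e) * binH (e / (1 + e)).
Proof.
move=> pA0 pA1 pB0 pB1 pP0 pP1 pN0 pN1 cA cB E0 E1 trB trP.
have [u cP] := condent_exists pP0 pP1; have [v cN] := condent_exists pN0 pN1.
have [w cS] := condent_exists (psdmxD pA0 pN0) (psdmxD pA1 pN1).
have H1 := condent_superadd pA0 pA1 cA pN0 pN1 cN cS.
have H2 := condent_ge0 pN0 pN1 cN.
rewrite E0 E1 in cS.
have H3 := condent_add_le pB0 pB1 cB pP0 pP1 cP cS trB trP.
have H4 := condent_le_trace pP0 pP1 cP trP.
lra.
Qed.

(** * The states of the attack as mixtures of rank-one blocks *)

Definition projmx n (v : 'cV[C]_n) : 'M[C]_n := v *m v^t*.

Lemma psdmx_proj n (v : 'cV[C]_n) : psdmx (projmx v).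
Proof.
split=> [|x]; first by rewrite /projmx adjmxM trmxCK.
rewrite /projmx mulmxA -mulmxA -adjmxM mxE big_ord1 !mxE.
exact: mul_conjC_ge0.
Qed.

Lemma psdmx_scale n (c : R) (A : 'M[C]_n) : 0 <= c -> psdmx A ->
  psdmx (c%:C *: A).
Proof.
move=> c0 [hA pA]; split=> [|x].
  by rewrite linearZ /= map_mxZ /= conjCR hA.
by rewrite -scalemxAr -scalemxAl mxE mulr_ge0 ?ler0c.
Qed.

Lemma adjmxZ m n (c : R) (A : 'M[C]_(m, n)) : (c%:C *: A)^t* = c%:C *: A^t*.
Proof. by rewrite linearZ /= map_mxZ /= conjCR. Qed.

Lemma projmxZ n (c : R) (v : 'cV[C]_n) :
  projmx (c%:C *: v) = (c * c)%:C *: projmx v.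
Proof. by rewrite /projmx adjmxZ -scalemxAl -scalemxAr scalerA rmorphM. Qed.

Definition crossmx n (v w : 'cV[C]_n) : 'M[C]_n := v *m w^t* + w *m v^t*.

Lemma projmx_comb n (a b : R) (v w : 'cV[C]_n) :
  projmx (a%:C *: v + b%:C *: w) = (a * a)%:C *: projmx v +
    (b * b)%:C *: projmx w + (a * b)%:C *: crossmx v w.
Proof.
rewrite /projmx /crossmx adjmxD !adjmxZ mulmxDl !mulmxDr.
rewrite -!scalemxAr -!scalemxAl !scalerA.
move: (v *m v^t*) (w *m w^t*) (v *m w^t*) (w *m v^t*) => vv ww vw wv.
by apply/matrixP => i j; rewrite !mxE !rmorphM /=; ring.
Qed.

Lemma mxtrace_projmx_comb n (a b : R) (v w : 'cV[C]_n) :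
  \tr (projmx (a%:C *: v + b%:C *: w)) = (a * a)%:C * \tr (projmx v) +
    (b * b)%:C * \tr (projmx w) + (a * b)%:C * \tr (crossmx v w).
Proof.
rewrite projmx_comb; move: (projmx v) (projmx w) (crossmx v w) => x y z.
by rewrite !mxtraceD !mxtraceZ.
Qed.

(** Each trace is twice the real part of an inner product. Unitarity of [V] controls only the sum of
    these products over the outcomes of [A_2], hence the pairing. *)
Lemma mxtrace_crossmx n (v w v' w' : 'cV[C]_n) :
  w^t* *m v + w'^t* *m v' = 0 ->
  \tr (crossmx v w) + \tr (crossmx v' w') = 0.
Proof.
move=> /(congr1 mxtrace); rewrite mxtraceD [X in X + _]mxtrace_mulC.
rewrite [X in _ + X]mxtrace_mulC mxtrace0 => orth.
have orth' : \tr (w *m v^t*) + \tr (w' *m v'^t*) = 0.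
  have := congr1 (fun z => z^*) orth.
  by rewrite rmorphD /= rmorph0 -!mxtrace_adj !adjmxM !trmxCK.
by rewrite /crossmx !mxtraceD addrACA orth orth' addr0.
Qed.

Lemma scale_exchange n (h s q : C) (e g e' g' x y : 'M[C]_n) :
  h *: (s *: e + q *: g + x + (s *: e' + q *: g' + y)) +
  h *: (q *: e + s *: g - x + (s *: e' + q *: g' - y)) =
  h *: (s *: e + q *: g - x + (s *: e' + q *: g' - y)) +
  h *: (q *: e + s *: g + x + (s *: e' + q *: g' + y)).
Proof.
rewrite -!(scalerDr h); congr (_ *: _).
move: (s *: e + _) (q *: e + _) (s *: e' + _) => a a' b.
rewrite (addrACA a x b y) (addrACA a' (- x) b (- y)).
rewrite (addrACA a (- x) b (- y)) (addrACA a' x b y) -opprD.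
by rewrite [LHS]addrACA [RHS]addrACA subrr addNr.
Qed.

(** * Positive blocks with prescribed coherences *)

Section Block.
Variables (n : nat) (s q : R) (E G E' G' : 'cV[C]_n).

(* With [s = sqrt (1 - Q)] and [q = sqrt Q], the coefficients [(s, q, s, q)],
   [(s, -q, s, -q)], [(q, s, s, q)] and [(q, -s, s, -q)] give the [A_1 = 0] blocks
   of [tau], [tau'], [P] and [N]; exchanging [s] and [q] gives those for [A_1 = 1]. *)
Definition mixblock (a b c d : R) : 'M[C]_n :=
  (1 / 2)%:C *: (projmx (a%:C *: E + b%:C *: G) +
                 projmx (c%:C *: E' + d%:C *: G')).

Lemma psdmx_mixblock a b c d : psdmx (mixblock a b c d).
Proof.
apply: psdmx_scale; first by lra.
by apply: psdmxD; exact: psdmx_proj.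
Qed.

(** On each side the cross terms of the two blocks cancel, and the diagonal terms agree because
    changing signs leaves squares unchanged. *)
Lemma mixblock_exchange :
  mixblock s q s q + mixblock q (- s) s (- q) =
  mixblock s (- q) s (- q) + mixblock q s s q.
Proof.
rewrite /mixblock !projmx_comb.
have -> : (q * s)%:C = (s * q)%:C by rewrite mulrC.
have -> : (q * - s)%:C = - (s * q)%:C by rewrite mulrN mulrC rmorphN.
have -> : (s * - q)%:C = - (s * q)%:C by rewrite mulrN rmorphN.
have -> : (- s * - s)%:C = (s * s)%:C by rewrite mulrNN.
have -> : (- q * - q)%:C = (q * q)%:C by rewrite mulrNN.
rewrite !scaleNr.
exact: (scale_exchange (1 / 2)%:C (s * s)%:C (q * q)%:C (projmx E) (projmx G)
  (projmx E') (projmx G') ((s * q)%:C *: crossmx E G)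
  ((s * q)%:C *: crossmx E' G')).
Qed.

Hypotheses (nE : \tr (projmx E) = (s * s)%:C) (nG : \tr (projmx G) = (q * q)%:C)
  (nE' : \tr (projmx E') = (q * q)%:C) (nG' : \tr (projmx G') = (s * s)%:C).
Hypothesis orth : G^t* *m E + G'^t* *m E' = 0.

(** The condition gives both cross terms the same coefficient, so [orth] removes their combined
    trace. *)
Lemma mxtrace_mixblock a b c d : a * b = c * d ->
  \tr (mixblock a b c d) = (1 / 2 * (a * a * (s * s) + b * b * (q * q) +
     (c * c * (q * q) + d * d * (s * s))))%:C.
Proof.
move=> abcd; rewrite mxtraceZ mxtraceD !mxtrace_projmx_comb.
rewrite nE nG nE' nG' abcd [RHS]rmorphM /=; congr (_ * _).
rewrite addrACA -mulrDr mxtrace_crossmx // mulr0 addr0.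
by rewrite -!rmorphM -!rmorphD.
Qed.
End Block.

(** The vectors [E_b], [F_b], [G_b], [H_b] stand for [e_0, e_1], then [f_0, f_1], then [f_2, f_3],
    then [e_2, e_3]. [T1] lists [b = 1] first so that its norms match the block lemmas with [s] and
    [q] exchanged. *)
Lemma condent_attack n (Q s q : R) (E0 E1 F0 F1 G0 G1 H0 H1 : 'cV[C]_n) sT sS
    (T0 := mixblock E0 G0 E1 G1) (T1 := mixblock F1 H1 F0 H0)
    (e := 4 * Q * (1 - Q)) :
  s * s = 1 - Q -> q * q = Q ->
  \tr (projmx E0) = (1 - Q)%:C -> \tr (projmx E1) = Q%:C ->
  \tr (projmx F0) = (1 - Q)%:C -> \tr (projmx F1) = Q%:C ->
  \tr (projmx G0) = Q%:C -> \tr (projmx G1) = (1 - Q)%:C ->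
  \tr (projmx H0) = Q%:C -> \tr (projmx H1) = (1 - Q)%:C ->
  G0^t* *m E0 + G1^t* *m E1 = 0 -> H0^t* *m F0 + H1^t* *m F1 = 0 ->
  condent (T0 s q s q) (T1 q s q s) sT ->
  condent ((1 / 2)%:C *: (T0 s q s q + T0 s (- q) s (- q)))
          ((1 / 2)%:C *: (T1 q s q s + T1 q (- s) q (- s))) sS ->
  sT <= 2 * sS /\ 2 * sT <= 2 * sS + (e + (1 + e) * binH (e / (1 + e))).
Proof.
move=> ss qq; rewrite -ss -qq => nE0 nE1 nF0 nF1 nG0 nG1 nH0 nH1 oEG.
rewrite [X in X = 0 -> _]addrC => oFH cT cS.
have p0 a b c d : psdmx (T0 a b c d) by exact: psdmx_mixblock.
have p1 a b c d : psdmx (T1 a b c d) by exact: psdmx_mixblock.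
have [sT' cT'] := condent_exists (p0 s (- q) s (- q)) (p1 q (- s) q (- s)).
have trT : \tr (T0 s (- q) s (- q) + T1 q (- s) q (- s)) = 1.
  rewrite mxtraceD (mxtrace_mixblock nE0 nG0 nE1 nG1 oEG) //.
  rewrite (mxtrace_mixblock nF1 nH1 nF0 nH0 oFH) // -rmorphD /=.
  rewrite !mulrNN ss qq -[RHS]/(1%:C); congr (_%:C).
  by field.
(* [P] puts the small coefficient on the long vectors: in each block all four terms of the trace
   formula equal [Q (1 - Q)], so the block has trace [2 Q (1 - Q)]. *)
have trP : \tr (T0 q s s q + T1 s q q s) = e%:C.
  rewrite mxtraceD (mxtrace_mixblock nE0 nG0 nE1 nG1 oEG) 1?mulrC //.
  rewrite (mxtrace_mixblock nF1 nH1 nF0 nH0 oFH) 1?mulrC // -rmorphD /=.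
  by rewrite ss qq /e; congr (_%:C); field.
have H1' := condent_continuity (p0 s q s q) (p1 q s q s) (p0 s (- q) s (- q))
  (p1 q (- s) q (- s)) (p0 q s s q) (p1 s q q s) (p0 q (- s) s (- q))
  (p1 s (- q) q (- s)) cT cT' (mixblock_exchange s q E0 G0 E1 G1)
  (mixblock_exchange q s F1 H1 F0 H0) trT trP.
have half : 0 < 1 / 2 :> R by lra.
rewrite !scalerDr in cS.
(* Superadditivity on the halves of [tau] and [tau'] gives [sT + sT' <= 2 * sS]; [sT' >= 0] then
   yields the first bound and [H1'] the second. *)
have H2 := condent_superadd
  (psdmx_scale (ltW half) (p0 _ _ _ _)) (psdmx_scale (ltW half) (p1 _ _ _ _))
  (condent_scale (p0 _ _ _ _) (p1 _ _ _ _) cT half)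
  (psdmx_scale (ltW half) (p0 _ _ _ _)) (psdmx_scale (ltW half) (p1 _ _ _ _))
  (condent_scale (p0 _ _ _ _) (p1 _ _ _ _) cT' half) cS.
have H3 := condent_ge0 (p0 _ _ _ _) (p1 _ _ _ _) cT'.
by split; lra.
Qed.

(** * Translation of the concrete sums over [nat] into matrices *)

Definition toC (z : Cpx) : C := Complex (Defs.Re z) (Defs.Im z).

Lemma toC_mul a b : toC (Cmul a b) = toC a * toC b. Proof. by []. Qed.
Lemma toC_conj a : toC (Cconj a) = (toC a)^*. Proof. by []. Qed.
Lemma toC_real r : toC (RtoC r) = r%:C. Proof. by []. Qed.

Lemma toC_sum n f : toC (Csum n f) = \sum_(i < n) toC (f i).
Proof.
elim: n => [|n IH]; first by rewrite big_ord0.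
by rewrite big_ord_recr /= -IH.
Qed.

Lemma rsum_ord n f : rsum n f = \sum_(i < n) f i.
Proof.
elim: n => [|n IH]; first by rewrite big_ord0.
by rewrite big_ord_recr /= -IH.
Qed.

Lemma toC_kron i j : toC (kron i j) = (i == j)%:R.
Proof.
rewrite /kron; have -> : Nat.eqb i j = (i == j).
  by apply/idP/idP => [/PeanoNat.Nat.eqb_eq/eqP|/eqP/PeanoNat.Nat.eqb_eq].
by case: eqP.
Qed.

Definition mxC n (M : nat -> nat -> Cpx) : 'M[C]_n := \matrix_(i, j) toC (M i j).
Definition colC n (v : nat -> Cpx) : 'cV[C]_n := \col_i toC (v i).

Lemma vn_entropy_vent n M s : vn_entropy n M s ->
  exists U lam, spectral_dec (mxC n M) U lam /\ s = vent lam.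
Proof.
move=> [lam [u [orth [eqM ->]]]].
(* The conjugate makes row [k] the bra of the eigenvector [u k], as [spectral_dec] expects. *)
exists (\matrix_(k, i) (toC (u k i))^*), (fun k : 'I_n => lam k); split.
  split.
    apply/unitarymxP/matrixP => k l; rewrite !mxE.
    have := orth k l (ssrnat.ltP (ltn_ord k)) (ssrnat.ltP (ltn_ord l)).
    move/(congr1 toC); rewrite toC_sum toC_kron => E.
    rewrite -[(k == l)]/(k == l :> nat) -E; apply: eq_bigr => i _.
    by rewrite !mxE /= conjCK toC_mul toC_conj.
  apply/matrixP => i j; rewrite !mxE eqM; try exact/ssrnat.ltP.
  rewrite toC_sum; apply: eq_bigr => k _.
  by rewrite mul_mx_diag !mxE /= conjCK !toC_mul toC_conj toC_real mulrCA mulrA.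
by rewrite rsum_ord.
Qed.

Definition blockC n (rho : op3) (a : nat) : 'M[C]_n :=
  mxC n (fun x x' => Csum 2 (fun b => rho a b x a b x')).

Lemma cond_entropy_condent n rho s : cond_entropy_ZE n rho s ->
  condent (blockC n rho 0) (blockC n rho 1) s.
Proof.
move=> [sZE [sE [vZE [vE ->]]]].
have n2 : (2 * n)%coq_nat = (n + n)%N by rewrite multE mul2n addnn.
rewrite n2 in vZE.
have [U [lam [sU ->]]] := vn_entropy_vent vZE.
have [V [mu [sV ->]]] := vn_entropy_vent vE.
exists U, lam, V, mu; split=> //.
  suff <- : mxC (n + n) (rhoZE n rho) = cqmx (blockC n rho 0) (blockC n rho 1) by [].
  (* Division by [n] reads off the bit of [A_1]: the first [n] indices form the block 0 and the next
     [n] the block 1. *)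
  have lo (i : 'I_n) : Nat.div i n = 0%N /\ Nat.modulo i n = i.
    by split; [apply: PeanoNat.Nat.div_small|apply: PeanoNat.Nat.mod_small];
       exact/ssrnat.ltP.
  have hi (i : 'I_n) : Nat.div (n + i)%N n = 1%N /\ Nat.modulo (n + i)%N n = i.
    split; [apply/esym/(PeanoNat.Nat.div_unique _ _ _ i) |
            apply/esym/(PeanoNat.Nat.mod_unique _ _ 1)]; try exact/ssrnat.ltP.
      by rewrite PeanoNat.Nat.mul_1_r.
    by rewrite PeanoNat.Nat.mul_1_r.
  apply/matrixP => i j; rewrite /cqmx mxE.
  case: (split_ordP i) => i' ->; case: (split_ordP j) => j' ->.
  - by rewrite block_mxEul mxE /rhoZE /= !(lo _).1 !(lo _).2.
  - by rewrite block_mxEur mxE /rhoZE /= !(lo _).1 !(hi _).1.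
  - by rewrite block_mxEdl mxE /rhoZE /= !(lo _).1 !(hi _).1.
  - by rewrite block_mxEdr mxE /rhoZE /= !(hi _).1 !(hi _).2.
suff <- : mxC n (rhoE n rho) = blockC n rho 0 + blockC n rho 1 by [].
by apply/matrixP => i j; rewrite !mxE /rhoE toC_sum !big_ord_recl big_ord0 addr0.
Qed.

Lemma mxtrace_projmx_colC n v : \tr (projmx (colC n v)) = (vnorm2 n v)%:C.
Proof.
rewrite /vnorm2 rsum_ord rmorph_sum; apply: eq_bigr => i _.
rewrite !mxE big_ord1 !mxE /= mulrC -toC_conj -toC_mul.
rewrite /toC /= /Cnorm2; congr Complex;
  by rewrite /= !(RminusE, RplusE, RmultE, RoppE); ring.
Qed.

Lemma blockC_proj3 n psi a :
  blockC n (proj3 psi) a = projmx (colC n (psi a 0)) + projmx (colC n (psi a 1%N)).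
Proof.
apply/matrixP => i j; rewrite mxE toC_sum !big_ord_recl big_ord0 addr0.
by rewrite !mxE !big_ord1 !mxE.
Qed.

Lemma blockC_add n r1 r2 a :
  blockC n (op3_add r1 r2) a = blockC n r1 a + blockC n r2 a.
Proof.
apply/matrixP => i j; rewrite !mxE !toC_sum -big_split; exact: eq_bigr.
Qed.

Lemma blockC_scale n c r a : blockC n (op3_scale c r) a = c%:C *: blockC n r a.
Proof.
apply/matrixP => i j; rewrite !mxE !toC_sum mulr_sumr; exact: eq_bigr.
Qed.

Definition opblock n (V : op2) b a : 'M[C]_n := mxC n (fun y x => V b y a x).

Lemma colC_applyV n V phi b : colC n (applyV n V phi b) =
  opblock n V b 0 *m colC n (phi 0) + opblock n V b 1 *m colC n (phi 1%N).
Proof.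
apply/matrixP => i j; rewrite !mxE toC_sum !big_ord_recl big_ord0 addr0.
by rewrite !toC_sum; congr (_ + _); apply: eq_bigr => k _; rewrite !mxE.
Qed.

Lemma colC_compV0 n V v b : colC n (compV n V 0 v b) = opblock n V b 0 *m colC n v.
Proof.
rewrite [LHS]colC_applyV (_ : colC n (ketE 0 v 1%N) = 0) ?mulmx0 ?addr0 //.
by apply/matrixP => i j; rewrite !mxE.
Qed.

Lemma colC_compV1 n V v b : colC n (compV n V 1 v b) = opblock n V b 1 *m colC n v.
Proof.
rewrite [LHS]colC_applyV (_ : colC n (ketE 1 v 0) = 0) ?mulmx0 ?add0r //.
by apply/matrixP => i j; rewrite !mxE.
Qed.

Lemma colC_scale n c v : colC n (fun x => Cmul (RtoC c) (v x)) = c%:C *: colC n v.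
Proof. by apply/matrixP => i j; rewrite !mxE. Qed.

(** The off-diagonal block of [V* V = 1], between [A_2 = 1] and [A_2 = 0], is zero. *)
Lemma compV_orth n V v w : unitary2 n V ->
  (colC n (compV n V 1 w 0))^t* *m colC n (compV n V 0 v 0) +
  (colC n (compV n V 1 w 1))^t* *m colC n (compV n V 0 v 1) = 0.
Proof.
case=> iso _; rewrite !colC_compV0 !colC_compV1 !adjmxM !mulmxA.
rewrite -mulmxDl -!(mulmxA ((colC n w)^t*)) -mulmxDr.
suff -> : (opblock n V 0 1)^t* *m opblock n V 0 0 +
          (opblock n V 1 1)^t* *m opblock n V 1 0 = 0 by rewrite mulmx0 mul0mx.
apply/matrixP => i j.
have /(congr1 toC) := iso 1%N i 0%N j (le_n 2) (ssrnat.ltP (ltn_ord i))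
  (le_S _ _ (le_n 1)) (ssrnat.ltP (ltn_ord j)).
rewrite toC_mul !toC_kron mul0r toC_sum !big_ord_recl big_ord0 addr0 !toC_sum.
move=> iso0; rewrite !mxE -[RHS]iso0.
by congr (_ + _); apply: eq_bigr => k _; rewrite !mxE.
Qed.

Lemma mixblock_swap n (E G E' G' : 'cV[C]_n) a b c d :
  mixblock E G E' G' a b c d = mixblock E' G' E G c d a b.
Proof. by congr (_ *: _); exact: addrC. Qed.

Lemma scale_parallelogram n (h : C) (x y x' y' c c' : 'M[C]_n) : h + h = 1 ->
  h *: (x + y + c + (x' + y' + c')) + h *: (x + y - c + (x' + y' - c')) =
  x + x' + (y + y').
Proof.
move=> hh; rewrite -(scalerDr h).
rewrite (addrACA (x + y) c) (addrACA (x + y) (- c)) -opprD.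
move: (c + c') => z; rewrite addrACA subrr addr0.
by rewrite scalerDr -scalerDl hh scale1r addrACA.
Qed.

(** Parallelogram identity: the opposite signs of [Phi+] and [Phi-] remove the coherences, which
    gives [sigma = (tau + tau') / 2] block by block. *)
Lemma mixblock_parity n (a b : R) (v w v' w' : 'cV[C]_n) :
  mixblock v w v' w' a b a b + mixblock v w v' w' a (- b) a (- b) =
  projmx (a%:C *: v) + projmx (a%:C *: v') +
    (projmx (b%:C *: w) + projmx (b%:C *: w')).
Proof.
rewrite /mixblock !projmx_comb !projmxZ mulrNN mulrN rmorphN !scaleNr.
apply: scale_parallelogram.
by rewrite -rmorphD /=; congr (_%:C); lra.
Qed.

(** * The blocks of [tau] and [sigma] in terms of the attack vectors *)

Section Attack.
Variables (n : nat) (V : op2) (Q : R) (eta : Cpx) (k0 k1 : nat -> Cpx).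
Let s := sqrt (1 - Q).
Let q := sqrt Q.
Let E b := colC n (compV n V 0 k0 b).
Let F b := colC n (compV n V 0 (fvec eta k0 k1) b).
Let G b := colC n (compV n V 1 (evec eta k0 k1) b).
Let H b := colC n (compV n V 1 k0 b).

Lemma colC_IxV_Rw b :
  [/\ colC n (IxV n V (Rw00 Q eta k0 k1) 0 b) = s%:C *: E b,
      colC n (IxV n V (Rw11 Q eta k0 k1) 0 b) = q%:C *: G b,
      colC n (IxV n V (Rw00 Q eta k0 k1) 1 b) = q%:C *: F b &
      colC n (IxV n V (Rw11 Q eta k0 k1) 1 b) = s%:C *: H b].
Proof.
have Z : colC n (fun=> Czero) = 0 by apply/matrixP => i j; rewrite !mxE.
split.
- apply: (etrans (colC_applyV n V (Rw00 Q eta k0 k1 0) b)).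
  rewrite [X in _ + _ *m X]Z mulmx0 addr0 [X in _ *: X]colC_compV0 scalemxAr.
  by rewrite -colC_scale.
- apply: (etrans (colC_applyV n V (Rw11 Q eta k0 k1 0) b)).
  rewrite [X in _ *m X + _]Z mulmx0 add0r [X in _ *: X]colC_compV1 scalemxAr.
  by rewrite -colC_scale.
- apply: (etrans (colC_applyV n V (Rw00 Q eta k0 k1 1) b)).
  rewrite [X in _ + _ *m X]Z mulmx0 addr0 [X in _ *: X]colC_compV0 scalemxAr.
  by rewrite -colC_scale.
- apply: (etrans (colC_applyV n V (Rw11 Q eta k0 k1 1) b)).
  rewrite [X in _ *m X + _]Z mulmx0 add0r [X in _ *: X]colC_compV1 scalemxAr.
  by rewrite -colC_scale.
Qed.

Lemma half_sqr : / sqrt 2 * / sqrt 2 = 1 / 2 :> R.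
Proof.
rewrite -[LHS]/(Rmult _ _) -Rinv_mult sqrt_def; last exact: Rlt_le Rlt_0_2.
by rewrite RinvE div1r.
Qed.

Lemma blockC_tau : let T := tau_state n V Q eta k0 k1 in
  blockC n T 0 = mixblock (E 0) (G 0) (E 1) (G 1) s q s q /\
  blockC n T 1 = mixblock (F 1) (H 1) (F 0) (H 0) q s q s.
Proof.
rewrite /= /tau_state !blockC_proj3 !colC_scale !projmxZ half_sqr -!scalerDr.
have D a b : colC n (fun x => Cadd (IxV n V (Rw00 Q eta k0 k1) a b x)
   (IxV n V (Rw11 Q eta k0 k1) a b x)) =
   colC n (IxV n V (Rw00 Q eta k0 k1) a b) + colC n (IxV n V (Rw11 Q eta k0 k1) a b).
  by apply/matrixP => i j; rewrite !mxE.
rewrite !D; have [-> -> -> ->] := colC_IxV_Rw 0.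
have [-> -> -> ->] := colC_IxV_Rw 1; split; first by [].
by rewrite mixblock_swap.
Qed.

Lemma blockC_sigma : let S := sigma_state n V Q eta k0 k1 in
  blockC n S 0 = (1 / 2)%:C *: (mixblock (E 0) (G 0) (E 1) (G 1) s q s q +
     mixblock (E 0) (G 0) (E 1) (G 1) s (- q) s (- q)) /\
  blockC n S 1 = (1 / 2)%:C *: (mixblock (F 1) (H 1) (F 0) (H 0) q s q s +
     mixblock (F 1) (H 1) (F 0) (H 0) q (- s) q (- s)).
Proof.
have halfE : Rdiv (IZR 1) (IZR 2) = 1 / 2 by rewrite RdivE.
cbv zeta; rewrite /sigma_state !blockC_add !blockC_scale !blockC_proj3 halfE.
have [-> -> -> ->] := colC_IxV_Rw 0.
have [-> -> -> ->] := colC_IxV_Rw 1.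
split; apply: (etrans (esym (scalerDr _ _ _))); congr (_ *: _).
  exact/esym/mixblock_parity.
rewrite (mixblock_swap _ _ _ _ q s) (mixblock_swap _ _ _ _ q (- s)).
exact/esym/mixblock_parity.
Qed.
End Attack.

Local Open Scope R_scope.

Theorem theorem3
  (d : nat) (k0 k1 : nat -> Cpx) (Q : R) (eta : Cpx) (V : op2)
  (Hk : inner d k0 k0 = Cone /\ inner d k1 k1 = Cone /\ inner d k0 k1 = Czero)
  (HQ : 0 <= Q <= 1)
  (Heta : Cnorm2 eta <= 1)
  (HV : unitary2 d V)
  (He0 : vnorm2 d (compV d V 0 k0 0) = 1 - Q)
  (He3 : vnorm2 d (compV d V 1 k0 1) = 1 - Q)
  (Hf0 : vnorm2 d (compV d V 0 (fvec eta k0 k1) 0) = 1 - Q)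
  (Hf3 : vnorm2 d (compV d V 1 (evec eta k0 k1) 1) = 1 - Q)
  (He1 : vnorm2 d (compV d V 0 k0 1) = Q)
  (He2 : vnorm2 d (compV d V 1 k0 0) = Q)
  (Hf1 : vnorm2 d (compV d V 0 (fvec eta k0 k1) 1) = Q)
  (Hf2 : vnorm2 d (compV d V 1 (evec eta k0 k1) 0) = Q)
  (sSigma sTau : R)
  (HsSigma : cond_entropy_ZE d (sigma_state d V Q eta k0 k1) sSigma)
  (HsTau : cond_entropy_ZE d (tau_state d V Q eta k0 k1) sTau) :
  sSigma >= fQ Q sTau.
Proof.
have := cond_entropy_condent HsTau; have := cond_entropy_condent HsSigma.
have [-> ->] := blockC_tau d V Q eta k0 k1.
have [-> ->] := blockC_sigma d V Q eta k0 k1.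
move=> cS cT.
have [Q0 Q1] := HQ.
have Q1' : 0 <= 1 - Q by Lra.lra.
have ss := sqrt_def _ Q1'; have qq := sqrt_def _ Q0.
have trE v w r : vnorm2 d (compV d V v w 0) = r ->
    mxtrace (projmx (colC d (compV d V v w 0))) = real_complex R r.
  by rewrite mxtrace_projmx_colC => ->.
have trE' v w r : vnorm2 d (compV d V v w 1) = r ->
    mxtrace (projmx (colC d (compV d V v w 1))) = real_complex R r.
  by rewrite mxtrace_projmx_colC => ->.
have [/RleP H1 /RleP H2] := condent_attack ss qq (trE _ _ _ He0) (trE' _ _ _ He1)
  (trE _ _ _ Hf0) (trE' _ _ _ Hf1) (trE _ _ _ Hf2) (trE' _ _ _ Hf3)
  (trE _ _ _ He2) (trE' _ _ _ He3)
  (compV_orth k0 (evec eta k0 k1) HV) (compV_orth (fvec eta k0 k1) k0 HV) cT cS.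
have four : (4%:R)%R = 4 :> R by rewrite -[LHS]/(1 + (1 + (1 + 1))); Lra.lra.
rewrite four in H2; pose e := 4 * Q * (1 - Q).
have {}H1 : sTau <= 2 * sSigma by exact: H1.
have {}H2 : 2 * sTau <= 2 * sSigma + (e + (1 + e) * binH (Rdiv e (Rplus 1 e))).
  by exact: H2.
have delta2 : 2 * deltaQ Q = e + (1 + e) * binH (Rdiv e (Rplus 1 e)).
  by rewrite /deltaQ -/e; move: (binH _) => b; rewrite /e; Lra.lra.
(* The bounds [sTau - deltaQ Q] and [sTau / 2] both hold unconditionally, so either branch of [fQ]
   is covered. *)
by rewrite /fQ; case: Rle_dec => _; Lra.lra.
Qed.
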